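(* Let $\mathbb{H}_1$ and $\mathbb{H}_2$ be localic $\mathcal{S}$-fibered categories endowed with localic internal tensor structures $(\otimes_1,m_1)$ and $(\otimes_2,m_2)$, respectively, and let $R: \mathbb{H}_1\to\mathbb{H}_2$ be a localic morphism of $\mathcal{S}$-fibered categories. Let $\rho$ be a triangulated internal tensor structure on the underlying morphism of $\mathcal{U}$-fibered categories $R: \mathbb{H}_1 \to \mathbb{H}_2$ (with respect to the restrictions of $(\otimes_1,m_1)$ and $(\otimes_2,m_2)$ to $\mathcal{U}$). Then there exists a unique triangulated internal tensor structure $\tilde{\rho}$ on the morphism of $\mathcal{S}$-fibered categories $R$ whose restriction to $\mathcal{U}$ coincides with $\rho$.
   Context: Base category. $\mathcal{S}$ is a fixed small category with finite products and final object $\ast$, equipped with two (possibly non-full) subcategories $\mathcal{S}^{sm}$ (its morphisms are called smooth morphisms) and $\mathcal{S}^{cl}$ (its morphisms are called closed immersions) such that: (i) both have the same objects as $\mathcal{S}$ and contain all isomorphisms of $\mathcal{S}$; (ii) for every smooth $p: P \to S$ and every $f: T \to S$ in $\mathcal{S}$ the fibered product $P\times_S T$ exists in $\mathcal{S}$ and its projection to $T$ is smooth; (iii) for every smooth $p: P\to S$ and closed immersion $z: Z\to S$ the projection $P\times_S Z\to P$ is a closed immersion, and whenever $z: Z\to S$, $g: S\to V$ are morphisms of $\mathcal{S}$ with $gz$ a closed immersion, $z$ is a closed immersion; (iv) every $f: T\to S$ in $\mathcal{S}$ factors as $f=p\circ t$ with $t: T\to P$ a closed immersion and $p: P\to S$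 smooth. $\mathcal{U}$ is the full subcategory of $\mathcal{S}$ of all $Y$ such that $Y\to\ast$ is smooth; its smooth morphisms and closed immersions are those of $\mathcal{S}$ lying in $\mathcal{U}$. Moreover: (v) $\mathcal{S}$ has an initial object $\emptyset$; (vi) for every closed immersion $z: Z\to S$ there is a distinguished smooth morphism $u: U\to S$ (the open immersion complementary to $z$; $U$ is the open complement of $Z$ in $S$) such that for every $T\in\mathcal{S}$ composition with $u$ identifies $\mathrm{Hom}_{\mathcal{S}}(T,U)$ with the subset of those $f\in\mathrm{Hom}_{\mathcal{S}}(T,S)$ for which the square with sides $\emptyset\to T$, $f:T\to S$, $\emptyset\to Z$, $z: Z\to S$ is Cartesian; (vii) for every $S\in\mathcal{S}$ there is a finite sequence of closed immersions $\emptyset=Z_{-1}\to Z_0\to\cdots\to Z_n=S$ such that for each $r=0,\dots,n$ the open complement of $Z_{r-1}$ in $Z_r$ belongs to $\mathcal{U}$. Fibered categories. Let $\mathcal{C}$ be $\mathcal{S}$ or $\mathcal{U}$. A $\mathcal{C}$-fibered category $\mathbb{H}$ consists of a category $\mathbb{H}(S)$ for each $S\in\mathcal{C}$, a functor $f^*:\mathbb{H}(S)\to\mathbb{H}(T)$ for each $f: T\to S$ in $\mathcal{C}$, and natural isomorphisms $\mathsf{conn}_{f,g}:(gf)^*\xrightarrow{\sim} f^*g^*$ for composable $f: T\to S$, $g: S\to V$, such that $\mathrm{id}_S^*=\mathrm{id}_{\mathbb{H}(S)}$ and, for composable $f,g,h$, the two resulting isomorphisms $(hgf)^*\xrightarrow{\sim}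 f^*g^*h^*$ agree. Connection isomorphisms are written as equalities. An $\mathcal{S}$-fibered category restricts to a $\mathcal{U}$-fibered category, denoted by the same symbol; likewise for all structures below. Localic fibered categories. A triangulated $\mathcal{C}$-fibered category is one where all $\mathbb{H}(S)$ are triangulated categories, all $f^*$ are triangulated functors and all connection isomorphisms are isomorphisms of triangulated functors. It is localic if: (a) $\mathbb{H}(\emptyset)=0$; (b) for every smooth $p: P\to S$ the functor $p^*$ has a left adjoint $p_\#$, and for every Cartesian square with $p: P\to S$ smooth, $f: T\to S$, $p': P_T\to T$, $f': P_T\to P$, the composite $p'_\#f'^*\xrightarrow{\eta}p'_\#f'^*p^*p_\#=p'_\#p'^*f^*p_\#\xrightarrow{\epsilon}f^*p_\#$ is invertible; (c) for every closed immersion $z: Z\to S$ the functor $z^*$ has a right adjoint $z_*$, which is fully faithful; (d) for every closed immersion $z$ with complementary open immersion $u$, the pair $(z^*,u^* )$ is conservative. Here $\eta$ and $\epsilon$ denote units and co-units of adjunctions. Morphisms. A morphism of $\mathcal{C}$-fibered categories $R:\mathbb{H}_1\to\mathbb{H}_2$ consists of functors $R_S:\mathbb{H}_1(S)\to\mathbb{H}_2(S)$ for $S\in\mathcal{C}$ and natural isomorphisms $\theta_f: f^*R_S(A)\xrightarrow{\sim}R_T(f^*A)$ for $f: T\to S$ in $\mathcal{C}$ such that, for composable $f: T\to S$, $g: S\to V$, the isomorphism $\theta_{gf}$ equals the composite $f^*g^*R_V(A)\xrightarrow{\theta_g}f^*R_S(g^*A)\xrightarrow{\theta_f}R_T(f^*g^*A)$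 (modulo connection isomorphisms). It is triangulated if the $R_S$ are triangulated functors and the $\theta_f$ are isomorphisms of triangulated functors. A triangulated morphism between localic ones is localic if for every smooth $p: P\to S$ in $\mathcal{C}$ the composite $p_\#R_P(A)\xrightarrow{\eta}p_\#R_P(p^*p_\#A)\xrightarrow{\theta_p^{-1}}p_\#p^*R_S(p_\#A)\xrightarrow{\epsilon}R_S(p_\#A)$ is invertible. Tensor structures. An internal tensor structure $(\otimes,m)$ on a $\mathcal{C}$-fibered category $\mathbb{H}$ consists of functors $-\otimes-:\mathbb{H}(S)\times\mathbb{H}(S)\to\mathbb{H}(S)$ for $S\in\mathcal{C}$ and natural isomorphisms $m_f: f^*A\otimes f^*B\xrightarrow{\sim}f^*(A\otimes B)$ for $f: T\to S$ in $\mathcal{C}$ such that for composable $f,g$ the isomorphism $m_{gf}$ equals the composite $f^*g^*A\otimes f^*g^*B\xrightarrow{m_f}f^*(g^*A\otimes g^*B)\xrightarrow{m_g}f^*g^*(A\otimes B)$ (modulo connection isomorphisms). It is triangulated if the functors $\otimes$ are bi-triangulated and the $m_f$ are isomorphisms of bi-triangulated functors. A triangulated internal tensor structure is localic if for every smooth $p: P\to S$ in $\mathcal{C}$ the composites $p_\#(A\otimes p^*B)\xrightarrow{\eta}p_\#(p^*p_\#A\otimes p^*B)\xrightarrow{m}p_\#p^*(p_\#A\otimes B)\xrightarrow{\epsilon}p_\#A\otimes B$ and $p_\#(p^*A\otimes B)\xrightarrow{\eta}p_\#(p^*A\otimes p^*p_\#B)\xrightarrow{m}p_\#p^*(A\otimes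 p_\#B)\xrightarrow{\epsilon}A\otimes p_\#B$ are invertible. Tensor structures on morphisms. Given internal tensor structures $(\otimes_i,m_i)$ on $\mathbb{H}_i$ over $\mathcal{C}$ ($i=1,2$), an internal tensor structure $\rho$ on a morphism $R:\mathbb{H}_1\to\mathbb{H}_2$ is a family of natural isomorphisms $\rho_S: R_S(A)\otimes_2R_S(B)\xrightarrow{\sim}R_S(A\otimes_1B)$, $S\in\mathcal{C}$, such that for every $f: T\to S$ in $\mathcal{C}$ the composites $f^*R_S(A)\otimes_2f^*R_S(B)\xrightarrow{m_2}f^*(R_S(A)\otimes_2R_S(B))\xrightarrow{\rho}f^*R_S(A\otimes_1B)\xrightarrow{\theta}R_T(f^*(A\otimes_1B))$ and $f^*R_S(A)\otimes_2f^*R_S(B)\xrightarrow{\theta}R_T(f^*A)\otimes_2R_T(f^*B)\xrightarrow{\rho}R_T(f^*A\otimes_1f^*B)\xrightarrow{m_1}R_T(f^*(A\otimes_1B))$ coincide. When $R$ and the tensor structures are triangulated, $\rho$ is triangulated if each $\rho_S$ is an isomorphism of bi-triangulated functors (i.e. respects the triangulated structures). *)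

(* Defs.v *)
Set Implicit Arguments.
Unset Strict Implicit.
Unset Printing Implicit Defensive.

Declare Scope cat_scope.
Delimit Scope cat_scope with cat.
Local Open Scope cat_scope.

Record category := Category {
  ob :> Type;
  hom : ob -> ob -> Type;
  idm : forall A, hom A A;
  comp : forall A B C, hom B C -> hom A B -> hom A C;
  comp_idl : forall A B (f : hom A B), comp (idm B) f = f;
  comp_idr : forall A B (f : hom A B), comp f (idm A) = f;
  comp_assoc : forall A B C D (h : hom C D) (g : hom B C) (f : hom A B),
    comp h (comp g f) = comp (comp h g) f
}.
Arguments hom {c} A B.
Arguments idm {c} A.
Arguments comp {c A B C} g f.
Notation "g ∘ f" := (comp g f) (at level 40, left associativity) : cat_scope.

Definition is_iso (C : category) (A B : C) (f : hom A B) : Prop :=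
  exists g : hom B A, g ∘ f = idm A /\ f ∘ g = idm B.

Definition isomorphic (C : category) (A B : C) : Prop :=
  exists f : hom A B, is_iso f.

Definition is_zero (C : category) (A : C) : Prop :=
  forall B : C, (exists! f : hom A B, True) /\ (exists! f : hom B A, True).

(** The square with sides [q : Q -> P], [p' : Q -> T], [p : P -> S],
    [f : T -> S] is Cartesian. *)
Definition is_pullback (C : category) (Q P T S : C)
    (q : hom Q P) (p' : hom Q T) (p : hom P S) (f : hom T S) : Prop :=
  p ∘ q = f ∘ p' /\
  forall (X : C) (a : hom X P) (b : hom X T), p ∘ a = f ∘ b ->
    exists! h : hom X Q, q ∘ h = a /\ p' ∘ h = b.

Definition is_product (C : category) (A B P : C)
    (p1 : hom P A) (p2 : hom P B) : Prop :=
  forall (X : C) (a : hom X A) (b : hom X B),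
    exists! h : hom X P, p1 ∘ h = a /\ p2 ∘ h = b.

Definition full_sub (C : category) (P : C -> Prop) : category := {|
  ob := {A : C | P A};
  hom := fun A B => @hom C (proj1_sig A) (proj1_sig B);
  idm := fun A => idm (proj1_sig A);
  comp := fun A B D g f => g ∘ f;
  comp_idl := fun A B f => comp_idl f;
  comp_idr := fun A B f => comp_idr f;
  comp_assoc := fun A B D E h g f => comp_assoc h g f |}.

Definition prod_cat (C D : category) : category.
Proof.
refine {|
  ob := (C * D)%type;
  hom := fun X Y => (hom (fst X) (fst Y) * hom (snd X) (snd Y))%type;
  idm := fun X => (idm (fst X), idm (snd X));
  comp := fun X Y Z g f => (fst g ∘ fst f, snd g ∘ snd f) |}.
- intros X Y [f1 f2]; simpl; now rewrite !comp_idl.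
- intros X Y [f1 f2]; simpl; now rewrite !comp_idr.
- intros; simpl; now rewrite !comp_assoc.
Defined.

Record functor (C D : category) := Functor {
  fobj :> C -> D;
  fmap : forall A B : C, hom A B -> hom (fobj A) (fobj B);
  fmap_id : forall A : C, fmap (idm A) = idm (fobj A);
  fmap_comp : forall (A B E : C) (g : hom B E) (f : hom A B),
    fmap (g ∘ f) = fmap g ∘ fmap f
}.
Arguments fmap {C D} F {A B} f : rename.

Definition fid (C : category) : functor C C := {|
  fobj := fun A => A;
  fmap := fun A B f => f;
  fmap_id := fun A => eq_refl;
  fmap_comp := fun A B E g f => eq_refl |}.

Definition fcomp (C D E : category) (G : functor D E) (F : functor C D) :
  functor C E.
Proof.
refine {| fobj := fun A => G (F A); fmap := fun A B f => fmap G (fmap F f) |}.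
- intros; now rewrite !fmap_id.
- intros; now rewrite !fmap_comp.
Defined.

Definition fprod (C D C' D' : category) (F : functor C D) (F' : functor C' D') :
  functor (prod_cat C C') (prod_cat D D').
Proof.
refine {|
  fobj := fun X : prod_cat C C' => (F (fst X), F' (snd X)) : prod_cat D D';
  fmap := fun X Y f => (fmap F (fst f), fmap F' (snd f)) |}.
- intros; simpl; now rewrite !fmap_id.
- intros; simpl; now rewrite !fmap_comp.
Defined.

Definition partial_l (C D E : category) (T : functor (prod_cat C D) E) (B : D) :
  functor C E.
Proof.
refine {|
  fobj := fun A => T (A, B);
  fmap := fun A A' a => @fmap _ _ T (A, B) (A', B) (a, idm B) |}.
- intros A; exact (fmap_id T (A, B)).
- intros A A' A'' g f; rewrite <- fmap_comp; simpl; now rewrite comp_idl.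
Defined.

Definition partial_r (C D E : category) (T : functor (prod_cat C D) E) (A : C) :
  functor D E.
Proof.
refine {|
  fobj := fun B => T (A, B);
  fmap := fun B B' b => @fmap _ _ T (A, B) (A, B') (idm A, b) |}.
- intros B; exact (fmap_id T (A, B)).
- intros B B' B'' g f; rewrite <- fmap_comp; simpl; now rewrite comp_idl.
Defined.

Definition fully_faithful (C D : category) (F : functor C D) : Prop :=
  forall (A B : C) (g : hom (F A) (F B)), exists! f : hom A B, fmap F f = g.

Definition equivalence (C D : category) (F : functor C D) : Prop :=
  fully_faithful F /\ forall B : D, exists A : C, isomorphic (F A) B.

Record nat_iso (C D : category) (F G : functor C D) := NatIso {
  ni :> forall A : C, hom (F A) (G A);
  ni_inv : forall A : C, hom (G A) (F A);
  ni_nat : forall (A B : C) (f : hom A B), ni B ∘ fmap F f = fmap G f ∘ ni A;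
  ni_invK : forall A : C, ni_inv A ∘ ni A = idm (F A);
  ni_Kinv : forall A : C, ni A ∘ ni_inv A = idm (G A)
}.

(** [F] is left adjoint to [G]. *)
Record adjunction (C D : category) (F : functor C D) (G : functor D C) :=
  Adjunction {
  unit : forall A : C, hom A (G (F A));
  counit : forall B : D, hom (F (G B)) B;
  unit_nat : forall (A A' : C) (f : hom A A'),
    unit A' ∘ f = fmap G (fmap F f) ∘ unit A;
  counit_nat : forall (B B' : D) (g : hom B B'),
    counit B' ∘ fmap F (fmap G g) = g ∘ counit B;
  adj_triangle_l : forall A : C, counit (F A) ∘ fmap F (unit A) = idm (F A);
  adj_triangle_r : forall B : D, fmap G (counit B) ∘ unit (G B) = idm (G B)
}.

Record left_adjoint (C D : category) (G : functor D C) := LeftAdjoint {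
  ladj :> functor C D;
  ladj_adj : adjunction ladj G
}.
Record right_adjoint (C D : category) (F : functor C D) := RightAdjoint {
  radj :> functor D C;
  radj_adj : adjunction F radj
}.
Notation eta L := (unit (ladj_adj L)).
Notation eps L := (counit (ladj_adj L)).

Record additive (C : category) := Additive {
  hadd : forall A B : C, hom A B -> hom A B -> hom A B;
  hzero : forall A B : C, hom A B;
  hopp : forall A B : C, hom A B -> hom A B;
  haddA : forall (A B : C) (f g h : hom A B),
    hadd f (hadd g h) = hadd (hadd f g) h;
  haddC : forall (A B : C) (f g : hom A B), hadd f g = hadd g f;
  hadd0 : forall (A B : C) (f : hom A B), hadd (hzero A B) f = f;
  haddN : forall (A B : C) (f : hom A B), hadd (hopp f) f = hzero A B;
  comp_addl : forall (A B D : C) (g g' : hom B D) (f : hom A B),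
    hadd g g' ∘ f = hadd (g ∘ f) (g' ∘ f);
  comp_addr : forall (A B D : C) (g : hom B D) (f f' : hom A B),
    g ∘ hadd f f' = hadd (g ∘ f) (g ∘ f');
  has_zero : exists Z : C, is_zero Z;
  has_biproducts : forall A B : C, exists (P : C)
      (i1 : hom A P) (i2 : hom B P) (p1 : hom P A) (p2 : hom P B),
    p1 ∘ i1 = idm A /\ p2 ∘ i2 = idm B /\
    p1 ∘ i2 = hzero B A /\ p2 ∘ i1 = hzero A B /\
    hadd (i1 ∘ p1) (i2 ∘ p2) = idm P
}.

Definition additive_functor (C D : category) (aC : additive C) (aD : additive D)
    (F : functor C D) : Prop :=
  forall (A B : C) (f g : hom A B),
    fmap F (hadd aC f g) = hadd aD (fmap F f) (fmap F g).

(** The shift is only required to be an autoequivalence. *)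
Record triangulated (C : category) := Triangulated {
  tadd :> additive C;
  shift : functor C C;
  shift_additive : additive_functor tadd tadd shift;
  shift_equiv : equivalence shift;
  dist : forall A B D : C, hom A B -> hom B D -> hom D (shift A) -> Prop;
  tr0 : forall (A B D A' B' D' : C)
      (f : hom A B) (g : hom B D) (h : hom D (shift A))
      (f' : hom A' B') (g' : hom B' D') (h' : hom D' (shift A'))
      (a : hom A A') (b : hom B B') (d : hom D D'),
    is_iso a -> is_iso b -> is_iso d ->
    b ∘ f = f' ∘ a -> d ∘ g = g' ∘ b -> fmap shift a ∘ h = h' ∘ d ->
    dist f g h -> dist f' g' h';
  tr1_id : forall A Z : C, is_zero Z ->
    dist (idm A) (hzero tadd A Z) (hzero tadd Z (shift A));
  tr1_cone : forall (A B : C) (f : hom A B),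
    exists (D : C) (g : hom B D) (h : hom D (shift A)), dist f g h;
  tr2 : forall (A B D : C) (f : hom A B) (g : hom B D) (h : hom D (shift A)),
    dist f g h <-> dist g h (hopp tadd (fmap shift f));
  tr3 : forall (A B D A' B' D' : C)
      (f : hom A B) (g : hom B D) (h : hom D (shift A))
      (f' : hom A' B') (g' : hom B' D') (h' : hom D' (shift A'))
      (a : hom A A') (b : hom B B'),
    dist f g h -> dist f' g' h' -> b ∘ f = f' ∘ a ->
    exists d : hom D D', d ∘ g = g' ∘ b /\ fmap shift a ∘ h = h' ∘ d;
  tr4 : forall (X Y Z X' Y' Z' : C)
      (f : hom X Y) (f1 : hom Y Z') (f2 : hom Z' (shift X))
      (g : hom Y Z) (g1 : hom Z X') (g2 : hom X' (shift Y))
      (k1 : hom Z Y') (k2 : hom Y' (shift X)),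
    dist f f1 f2 -> dist g g1 g2 -> dist (g ∘ f) k1 k2 ->
    exists (u : hom Z' Y') (v : hom Y' X'),
      dist u v (fmap shift f1 ∘ g2) /\
      u ∘ f1 = k1 ∘ g /\ k2 ∘ u = f2 /\
      v ∘ k1 = g1 /\ g2 ∘ v = fmap shift f ∘ k2
}.

Record tri_functor (C D : category) (tC : triangulated C) (tD : triangulated D)
    (F : functor C D) := TriFunctor {
  tsh : nat_iso (fcomp F (shift tC)) (fcomp (shift tD) F);
  tf_additive : additive_functor tC tD F;
  tf_dist : forall (A B E : C) (f : hom A B) (g : hom B E)
      (h : hom E (shift tC A)),
    dist f g h -> @dist D tD _ _ _ (fmap F f) (fmap F g) (tsh A ∘ fmap F h)
}.

Definition tri_comp (C D E : category)
    (tC : triangulated C) (tD : triangulated D) (tE : triangulated E)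
    (G : functor D E) (F : functor C D)
    (tG : tri_functor tD tE G) (tF : tri_functor tC tD F) :
  tri_functor tC tE (fcomp G F).
Proof.
unshelve refine {| tsh := _ |}.
- refine {|
    ni := fun A => tsh tG (F A) ∘ fmap G (tsh tF A)
      : hom (fcomp (fcomp G F) (shift tC) A) (fcomp (shift tE) (fcomp G F) A);
    ni_inv := fun A => fmap G (ni_inv (tsh tF) A) ∘ ni_inv (tsh tG) (F A) |}.
  + intros A B f.
    pose proof (ni_nat (tsh tF) f) as HF.
    pose proof (ni_nat (tsh tG) (fmap F f)) as HG.
    simpl in *.
    rewrite <- comp_assoc, <- fmap_comp, HF, fmap_comp, !comp_assoc.
    now rewrite HG.
  + intros A; simpl.
    rewrite comp_assoc, <- (comp_assoc _ (ni_inv (tsh tG) (F A))).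
    pose proof (ni_invK (tsh tG) (F A)) as HG.
    pose proof (ni_invK (tsh tF) A) as HF.
    simpl in *.
    now rewrite HG, comp_idr, <- fmap_comp, HF, fmap_id.
  + intros A; simpl.
    rewrite comp_assoc, <- (comp_assoc _ (fmap G (tsh tF A))).
    pose proof (ni_Kinv (tsh tG) (F A)) as HG.
    pose proof (ni_Kinv (tsh tF) A) as HF.
    simpl in *.
    now rewrite <- fmap_comp, HF, fmap_id, comp_idr, HG.
- intros A B f g; simpl.
  now rewrite (tf_additive tF), (tf_additive tG).
- intros X Y Z f g h H; simpl.
  pose proof (tf_dist tG (tf_dist tF H)) as H'.
  now rewrite fmap_comp, comp_assoc in H'.
Defined.

(** Morphisms of triangulated functors. *)
Definition tri_nat (C D : category) (tC : triangulated C) (tD : triangulated D)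
    (F G : functor C D) (tF : tri_functor tC tD F) (tG : tri_functor tC tD G)
    (a : forall A : C, hom (F A) (G A)) : Prop :=
  forall A : C, tsh tG A ∘ a (shift tC A) = fmap (shift tD) (a A) ∘ tsh tF A.

(** The last condition is the usual sign rule: the two isomorphisms
    [T(A[1], B[1]) -> T(A, B)[2]] are opposite to each other. *)
Record bitri_functor (C D E : category) (tC : triangulated C)
    (tD : triangulated D) (tE : triangulated E)
    (T : functor (prod_cat C D) E) := BitriFunctor {
  bitri_l : forall B : D, tri_functor tC tE (partial_l T B);
  bitri_r : forall A : C, tri_functor tD tE (partial_r T A);
  bitri_l_nat : forall (A : C) (B B' : D) (b : hom B B'),
    tsh (bitri_l B') A ∘ fmap (partial_r T (shift tC A)) b
    = fmap (shift tE) (fmap (partial_r T A) b) ∘ tsh (bitri_l B) A;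
  bitri_r_nat : forall (A A' : C) (B : D) (a : hom A A'),
    tsh (bitri_r A') B ∘ fmap (partial_l T (shift tD B)) a
    = fmap (shift tE) (fmap (partial_l T B) a) ∘ tsh (bitri_r A) B;
  bitri_anticomm : forall (A : C) (B : D),
    fmap (shift tE) (tsh (bitri_l B) A) ∘ tsh (bitri_r (shift tC A)) B
    = hopp tE (fmap (shift tE) (tsh (bitri_r A) B)
               ∘ tsh (bitri_l (shift tD B)) A)
}.

(** [mu : F A ⊗' F B -> F (A ⊗ B)] is a morphism of bi-triangulated functors:
    a morphism of triangulated functors in each variable. *)
Definition bitri_nat (C D : category) (tC : triangulated C) (tD : triangulated D)
    (F : functor C D) (tF : tri_functor tC tD F)
    (T : functor (prod_cat C C) C) (bT : bitri_functor tC tC tC T)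
    (T' : functor (prod_cat D D) D) (bT' : bitri_functor tD tD tD T')
    (mu : nat_iso (fcomp T' (fprod F F)) (fcomp F T)) : Prop :=
  (forall B : C, tri_nat (tri_comp (bitri_l bT' (F B)) tF)
                         (tri_comp tF (bitri_l bT B)) (fun A => mu (A, B))) /\
  (forall A : C, tri_nat (tri_comp (bitri_r bT' (F A)) tF)
                         (tri_comp tF (bitri_r bT A)) (fun B => mu (A, B))).

Record base_category := BaseCategory {
  bcat :> category;
  has_products : forall X Y : bcat,
    exists (P : bcat) (p1 : hom P X) (p2 : hom P Y), is_product p1 p2;
  pt : bcat;
  to_pt : forall X : bcat, hom X pt;
  to_pt_uniq : forall (X : bcat) (f : hom X pt), f = to_pt X;

  smooth : forall X Y : bcat, hom X Y -> Prop;
  closed : forall X Y : bcat, hom X Y -> Prop;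
  smooth_comp : forall (X Y Z : bcat) (g : hom Y Z) (f : hom X Y),
    smooth g -> smooth f -> smooth (g ∘ f);
  closed_comp : forall (X Y Z : bcat) (g : hom Y Z) (f : hom X Y),
    closed g -> closed f -> closed (g ∘ f);
  smooth_iso : forall (X Y : bcat) (f : hom X Y), is_iso f -> smooth f;
  closed_iso : forall (X Y : bcat) (f : hom X Y), is_iso f -> closed f;

  smooth_pullback_exists : forall (P S T : bcat) (p : hom P S) (f : hom T S),
    smooth p ->
    exists (Q : bcat) (q : hom Q P) (p' : hom Q T), is_pullback q p' p f;
  smooth_pullback : forall (Q P T S : bcat)
      (q : hom Q P) (p' : hom Q T) (p : hom P S) (f : hom T S),
    smooth p -> is_pullback q p' p f -> smooth p';
  closed_smooth_pullback : forall (Q P Z S : bcat)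
      (q : hom Q P) (p' : hom Q Z) (p : hom P S) (z : hom Z S),
    smooth p -> closed z -> is_pullback q p' p z -> closed q;
  closed_cancel : forall (Z S V : bcat) (z : hom Z S) (g : hom S V),
    closed (g ∘ z) -> closed z;
  factorization : forall (T S : bcat) (f : hom T S),
    exists (P : bcat) (t : hom T P) (p : hom P S),
      closed t /\ smooth p /\ f = p ∘ t;

  empty : bcat;
  from_empty : forall X : bcat, hom empty X;
  from_empty_uniq : forall (X : bcat) (f : hom empty X), f = from_empty X;

  compl : forall (Z S : bcat) (z : hom Z S), closed z -> bcat;
  compl_incl : forall (Z S : bcat) (z : hom Z S) (Hz : closed z),
    hom (compl Hz) S;
  compl_smooth : forall (Z S : bcat) (z : hom Z S) (Hz : closed z),
    smooth (compl_incl Hz);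
  compl_inj : forall (Z S : bcat) (z : hom Z S) (Hz : closed z)
      (T : bcat) (g h : hom T (compl Hz)),
    compl_incl Hz ∘ g = compl_incl Hz ∘ h -> g = h;
  compl_image : forall (Z S : bcat) (z : hom Z S) (Hz : closed z)
      (T : bcat) (f : hom T S),
    (exists g : hom T (compl Hz), compl_incl Hz ∘ g = f) <->
    is_pullback (from_empty Z) (from_empty T) z f;

  (** [Z (S r)] is the [r]-th term of the sequence, starting from the index
      [-1]; the terms beyond [Z (S n)] are irrelevant. *)
  stratification : forall X : bcat,
    exists (n : nat) (Z : nat -> bcat) (z : forall r, hom (Z r) (Z (S r))),
      Z 0 = empty /\ Z (S n) = X /\
      forall r : nat, r <= n ->
        exists Hz : closed (z r), smooth (to_pt (compl Hz))
}.
Arguments smooth {b X Y} f.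
Arguments closed {b X Y} f.
Arguments empty {b}.

Definition in_U (S : base_category) (Y : S) : Prop := smooth (to_pt Y).
Definition Ucat (S : base_category) : category := full_sub (@in_U S).

(** The identity [f^* A -> g^* A] along an equality [f = g]. *)
Definition pull_eq (C : category) (fib : C -> category)
    (pull : forall (T S : C), hom T S -> functor (fib S) (fib T))
    (T S : C) (f g : hom T S) (E : f = g) (A : fib S) :
    hom (pull T S f A) (pull T S g A) :=
  match E in _ = g' return hom (pull T S f A) (pull T S g' A) with
  | eq_refl => idm (pull T S f A)
  end.

(** [f^*] is [pull f]. *)
Record fibered (C : category) := Fibered {
  fib :> C -> category;
  pull : forall (T S : C) (f : hom T S), functor (fib S) (fib T);
  pull_id : forall S : C, pull (idm S) = fid (fib S);
  conn : forall (T S V : C) (f : hom T S) (g : hom S V),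
    nat_iso (pull (g ∘ f)) (fcomp (pull f) (pull g));
  conn_cocycle : forall (T S V W : C) (f : hom T S) (g : hom S V) (h : hom V W)
      (A : fib W),
    fmap (pull f) (conn g h A) ∘ conn f (h ∘ g) A
    = conn f g (pull h A) ∘ conn (g ∘ f) h A
      ∘ pull_eq (@pull) (eq_sym (comp_assoc h g f)) A
}.
Arguments pull {C} H {T S} f : rename.
Arguments conn {C} H {T S V} f g : rename.

Record tri_fibered (C : category) (H : fibered C) := TriFibered {
  fib_tri :> forall S : C, triangulated (H S);
  pull_tri : forall (T S : C) (f : hom T S),
    tri_functor (fib_tri S) (fib_tri T) (pull H f);
  conn_tri : forall (T S V : C) (f : hom T S) (g : hom S V),
    tri_nat (pull_tri (g ∘ f)) (tri_comp (pull_tri f) (pull_tri g)) (conn H f g)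
}.
Arguments pull_tri {C H} D {T S} f : rename.

(** The connection isomorphism [q^* p^* = p'^* f^*] of a commutative square. *)
Definition pull_square (C : category) (H : fibered C) (Q P T S : C)
    (q : hom Q P) (p' : hom Q T) (p : hom P S) (f : hom T S)
    (E : p ∘ q = f ∘ p') (A : H S) :
    hom (pull H q (pull H p A)) (pull H p' (pull H f A)) :=
  conn H p' f A ∘ pull_eq (@pull C H) E A ∘ ni_inv (conn H q p) A.

Definition base_change (C : category) (H : fibered C) (Q P T S : C)
    (q : hom Q P) (p' : hom Q T) (p : hom P S) (f : hom T S)
    (E : p ∘ q = f ∘ p')
    (L : left_adjoint (pull H p)) (L' : left_adjoint (pull H p')) (A : H P) :
    hom (L' (pull H q A)) (pull H f (L A)) :=
  eps L' (pull H f (L A))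
  ∘ fmap L' (pull_square E (L A))
  ∘ fmap L' (fmap (pull H q) (eta L A)).

(** [p_#] is [sharp Hp] and [z_*] is [push Hz]. *)
Record localic (S : base_category) (H : fibered S) := Localic {
  loc_tri :> tri_fibered H;
  loc_empty : forall A : H empty, is_zero A;
  sharp : forall (P X : S) (p : hom P X), smooth p -> left_adjoint (pull H p);
  sharp_base_change : forall (Q P T X : S)
      (q : hom Q P) (p' : hom Q T) (p : hom P X) (f : hom T X)
      (Hp : smooth p) (Hp' : smooth p') (Hsq : is_pullback q p' p f) (A : H P),
    is_iso (base_change (proj1 Hsq) (sharp Hp) (sharp Hp') A);
  push : forall (Z X : S) (z : hom Z X), closed z -> right_adjoint (pull H z);
  push_ff : forall (Z X : S) (z : hom Z X) (Hz : closed z),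
    fully_faithful (push Hz);
  loc_conservative : forall (Z X : S) (z : hom Z X) (Hz : closed z)
      (A B : H X) (a : hom A B),
    is_iso (fmap (pull H z) a) -> is_iso (fmap (pull H (compl_incl Hz)) a) ->
    is_iso a
}.
Arguments sharp {S H} L {P X p} Hp : rename.
Arguments push {S H} L {Z X z} Hz : rename.

Record fib_mor (C : category) (H1 H2 : fibered C) := FibMor {
  mor :> forall S : C, functor (H1 S) (H2 S);
  theta : forall (T S : C) (f : hom T S),
    nat_iso (fcomp (pull H2 f) (mor S)) (fcomp (mor T) (pull H1 f));
  theta_comp : forall (T S V : C) (f : hom T S) (g : hom S V) (A : H1 V),
    fmap (mor T) (conn H1 f g A) ∘ theta (g ∘ f) A
    = theta f (pull H1 g A) ∘ fmap (pull H2 f) (theta g A)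
      ∘ conn H2 f g (mor V A)
}.
Arguments theta {C H1 H2} R {T S} f : rename.

Record tri_mor (C : category) (H1 H2 : fibered C)
    (D1 : tri_fibered H1) (D2 : tri_fibered H2) (R : fib_mor H1 H2) := TriMor {
  mor_tri :> forall S : C, tri_functor (D1 S) (D2 S) (R S);
  theta_tri : forall (T S : C) (f : hom T S),
    tri_nat (tri_comp (pull_tri D2 f) (mor_tri S))
            (tri_comp (mor_tri T) (pull_tri D1 f)) (theta R f)
}.

Definition mor_exchange (C : category) (H1 H2 : fibered C) (R : fib_mor H1 H2)
    (P S : C) (p : hom P S)
    (L1 : left_adjoint (pull H1 p)) (L2 : left_adjoint (pull H2 p)) (A : H1 P) :
    hom (L2 (R P A)) (R S (L1 A)) :=
  eps L2 (R S (L1 A))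
  ∘ fmap L2 (ni_inv (theta R p) (L1 A))
  ∘ fmap L2 (fmap (R P) (eta L1 A)).

Record localic_mor (S : base_category) (H1 H2 : fibered S)
    (D1 : localic H1) (D2 : localic H2) (R : fib_mor H1 H2) := LocalicMor {
  lmor_tri :> tri_mor D1 D2 R;
  lmor_sharp : forall (P X : S) (p : hom P X) (Hp : smooth p) (A : H1 P),
    is_iso (mor_exchange R (sharp D1 Hp) (sharp D2 Hp) A)
}.

Record tensor (C : category) (H : fibered C) := Tensor {
  tens :> forall S : C, functor (prod_cat (H S) (H S)) (H S);
  tens_m : forall (T S : C) (f : hom T S),
    nat_iso (fcomp (tens T) (fprod (pull H f) (pull H f)))
            (fcomp (pull H f) (tens S));
  tens_m_comp : forall (T S V : C) (f : hom T S) (g : hom S V) (A B : H V),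
    conn H f g (tens V (A, B)) ∘ tens_m (g ∘ f) (A, B)
    = fmap (pull H f) (tens_m g (A, B))
      ∘ tens_m f (pull H g A, pull H g B)
      ∘ @fmap _ _ (tens T)
          (pull H (g ∘ f) A, pull H (g ∘ f) B)
          (pull H f (pull H g A), pull H f (pull H g B))
          (conn H f g A, conn H f g B)
}.
Arguments tens_m {C H} W {T S} f : rename.

Record tri_tensor (C : category) (H : fibered C) (D : tri_fibered H)
    (W : tensor H) := TriTensor {
  tens_tri :> forall S : C, bitri_functor (D S) (D S) (D S) (W S);
  tens_m_tri : forall (T S : C) (f : hom T S),
    bitri_nat (pull_tri D f) (tens_tri S) (tens_tri T) (tens_m W f)
}.

Definition proj_formula_l (C : category) (H : fibered C) (W : tensor H)
    (P S : C) (p : hom P S) (L : left_adjoint (pull H p)) (A : H P) (B : H S) :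
    hom (L (W P (A, pull H p B))) (W S (L A, B)) :=
  eps L (W S (L A, B))
  ∘ fmap L (tens_m W p (L A, B))
  ∘ fmap L (fmap (partial_l (W P) (pull H p B)) (eta L A)).

Definition proj_formula_r (C : category) (H : fibered C) (W : tensor H)
    (P S : C) (p : hom P S) (L : left_adjoint (pull H p)) (A : H S) (B : H P) :
    hom (L (W P (pull H p A, B))) (W S (A, L B)) :=
  eps L (W S (A, L B))
  ∘ fmap L (tens_m W p (A, L B))
  ∘ fmap L (fmap (partial_r (W P) (pull H p A)) (eta L B)).

Record localic_tensor (S : base_category) (H : fibered S) (D : localic H)
    (W : tensor H) := LocalicTensor {
  ltens_tri :> tri_tensor D W;
  ltens_proj_l : forall (P X : S) (p : hom P X) (Hp : smooth p)
      (A : H P) (B : H X), is_iso (proj_formula_l W (sharp D Hp) A B);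
  ltens_proj_r : forall (P X : S) (p : hom P X) (Hp : smooth p)
      (A : H X) (B : H P), is_iso (proj_formula_r W (sharp D Hp) A B)
}.

Record mor_tensor (C : category) (H1 H2 : fibered C)
    (W1 : tensor H1) (W2 : tensor H2) (R : fib_mor H1 H2) := MorTensor {
  rho :> forall S : C,
    nat_iso (fcomp (W2 S) (fprod (R S) (R S))) (fcomp (R S) (W1 S));
  rho_pull : forall (T S : C) (f : hom T S) (A B : H1 S),
    theta R f (W1 S (A, B))
      ∘ fmap (pull H2 f) (rho S (A, B))
      ∘ tens_m W2 f (R S A, R S B)
    = fmap (R T) (tens_m W1 f (A, B))
      ∘ rho T (pull H1 f A, pull H1 f B)
      ∘ @fmap _ _ (W2 T)
          (pull H2 f (R S A), pull H2 f (R S B))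
          (R T (pull H1 f A), R T (pull H1 f B))
          (theta R f A, theta R f B)
}.

Definition tri_mor_tensor (C : category) (H1 H2 : fibered C)
    (D1 : tri_fibered H1) (D2 : tri_fibered H2)
    (W1 : tensor H1) (W2 : tensor H2)
    (tW1 : tri_tensor D1 W1) (tW2 : tri_tensor D2 W2)
    (R : fib_mor H1 H2) (tR : tri_mor D1 D2 R)
    (r : mor_tensor W1 W2 R) : Prop :=
  forall S : C, bitri_nat (tR S) (tW1 S) (tW2 S) (r S).

Section Restriction.
Variables (C : category) (Q : C -> Prop).
Notation CQ := (full_sub Q).

Definition res_fib (H : fibered C) : fibered CQ :=
  @Fibered CQ (fun S => H (proj1_sig S))
    (fun T S (f : hom T S) => pull H f)
    (fun S => pull_id H (proj1_sig S))
    (fun T S V (f : hom T S) (g : hom S V) => conn H f g)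
    (fun T S V W (f : hom T S) (g : hom S V) (h : hom V W) A =>
       @conn_cocycle C H _ _ _ _ f g h A).

Definition res_tri (H : fibered C) (D : tri_fibered H) :
    tri_fibered (res_fib H) :=
  @TriFibered CQ (res_fib H) (fun S => D (proj1_sig S))
    (fun T S (f : hom T S) => pull_tri D f)
    (fun T S V (f : hom T S) (g : hom S V) => conn_tri D f g).

Definition res_mor (H1 H2 : fibered C) (R : fib_mor H1 H2) :
    fib_mor (res_fib H1) (res_fib H2) :=
  @FibMor CQ (res_fib H1) (res_fib H2) (fun S => R (proj1_sig S))
    (fun T S (f : hom T S) => theta R f)
    (fun T S V (f : hom T S) (g : hom S V) A => theta_comp R f g A).

Definition res_tri_mor (H1 H2 : fibered C)
    (D1 : tri_fibered H1) (D2 : tri_fibered H2)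
    (R : fib_mor H1 H2) (tR : tri_mor D1 D2 R) :
    tri_mor (res_tri D1) (res_tri D2) (res_mor R) :=
  @TriMor CQ _ _ (res_tri D1) (res_tri D2) (res_mor R)
    (fun S => tR (proj1_sig S))
    (fun T S (f : hom T S) => theta_tri tR f).

Definition res_tensor (H : fibered C) (W : tensor H) : tensor (res_fib H) :=
  @Tensor CQ (res_fib H) (fun S => W (proj1_sig S))
    (fun T S (f : hom T S) => tens_m W f)
    (fun T S V (f : hom T S) (g : hom S V) A B => tens_m_comp W f g A B).

Definition res_tri_tensor (H : fibered C) (D : tri_fibered H)
    (W : tensor H) (tW : tri_tensor D W) :
    tri_tensor (res_tri D) (res_tensor W) :=
  @TriTensor CQ _ (res_tri D) (res_tensor W) (fun S => tW (proj1_sig S))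
    (fun T S (f : hom T S) => tens_m_tri tW f).

Definition res_mor_tensor (H1 H2 : fibered C)
    (W1 : tensor H1) (W2 : tensor H2) (R : fib_mor H1 H2)
    (r : mor_tensor W1 W2 R) :
    mor_tensor (res_tensor W1) (res_tensor W2) (res_mor R) :=
  @MorTensor CQ _ _ (res_tensor W1) (res_tensor W2) (res_mor R)
    (fun S => r (proj1_sig S))
    (fun T S (f : hom T S) A B => rho_pull r f A B).

End Restriction.

(* Main.v *)
(** Every [X] has a closed immersion [t] into some [Y] in [U], and
    [A = t^* t_* A] because [t_*] is fully faithful. Compatibility with [t^*]
    therefore forces the value of the tensor structure on [X] to be the
    conjugate of [t^* rho_Y] by the structural isomorphisms, which gives
    uniqueness; this conjugate is natural in all maps [t^* A' -> t^* C'] over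
    [X], since any such map is, up to the unit of [t^* -| t_*], the pullback of
    a map over [Y]. Given any [h : X -> Z] with [Z] in [U], the map
    [(h, t) : X -> Z x Y] is again a closed immersion, and comparing through it
    shows that the structure on [X] is compatible with [h], whatever the choice
    of [t]. Compatibility with [f : T -> X] follows by cancelling [t] in
    [t f], and compatibility with the shifts holds on objects [t^* A'], hence
    everywhere. *)

From Stdlib Require Import ssreflect FunctionalExtensionality ProofIrrelevance.
From Stdlib Require Import ClassicalEpsilon.
Require Import Defs.

Set Implicit Arguments.
Unset Strict Implicit.
Unset Printing Implicit Defensive.
Local Open Scope cat_scope.

(** * Composition and isomorphisms in a category *)

(** In a right-associated composite two adjacent factors need not form a subterm. Carrying the tail
    [k] along makes an equation between composites usable there. *)
Lemma comp_eq_r (C : category) (A B B' D X : C) (g : hom B D) (f : hom A B)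
    (g' : hom B' D) (f' : hom A B') (k : hom X A) :
  g ∘ f = g' ∘ f' -> g ∘ (f ∘ k) = g' ∘ (f' ∘ k).
Proof. by move=> E; rewrite !comp_assoc E. Qed.

Lemma comp_eq_r1 (C : category) (A B D X : C) (g : hom B D) (f : hom A B)
    (h : hom A D) (k : hom X A) : g ∘ f = h -> g ∘ (f ∘ k) = h ∘ k.
Proof. by move=> E; rewrite comp_assoc E. Qed.

Section Isomorphisms.
Variable C : category.

Lemma iso_comp (A B D : C) (g : hom B D) (f : hom A B) :
  is_iso g -> is_iso f -> is_iso (g ∘ f).
Proof.
move=> [g' [g'g gg']] [f' [f'f ff']]; exists (f' ∘ g'); split.
- by rewrite -comp_assoc (comp_eq_r1 _ g'g) comp_idl.
- by rewrite -comp_assoc (comp_eq_r1 _ ff') comp_idl.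
Qed.

Lemma iso_monic (A B X : C) (f : hom A B) (g h : hom X A) :
  is_iso f -> f ∘ g = f ∘ h -> g = h.
Proof.
move=> [f' [f'f _]] E.
by rewrite -(comp_idl g) -(comp_idl h) -f'f -!comp_assoc E.
Qed.

Lemma iso_epic (A B X : C) (f : hom A B) (g h : hom B X) :
  is_iso f -> g ∘ f = h ∘ f -> g = h.
Proof.
move=> [f' [_ ff']] E.
by rewrite -(comp_idr g) -(comp_idr h) -ff' !comp_assoc E.
Qed.

Lemma iso_cancel_r (A B D : C) (g : hom B D) (f : hom A B) :
  is_iso f -> is_iso (g ∘ f) -> is_iso g.
Proof.
move=> Hf [k [kgf gfk]]; exists (f ∘ k); split; last by rewrite comp_assoc.
by apply: (iso_epic Hf); rewrite -!comp_assoc kgf comp_idr comp_idl.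
Qed.

Lemma iso_cancel_l (A B D : C) (g : hom B D) (f : hom A B) :
  is_iso g -> is_iso (g ∘ f) -> is_iso f.
Proof.
move=> Hg [k [kgf gfk]]; exists (k ∘ g); split; first by rewrite -comp_assoc.
by apply: (iso_monic Hg); rewrite 2!comp_assoc gfk comp_idr comp_idl.
Qed.

End Isomorphisms.

(** * Functors, natural isomorphisms and adjunctions *)

Lemma fmap_iso (C D : category) (F : functor C D) (A B : C) (f : hom A B) :
  is_iso f -> is_iso (fmap F f).
Proof.
by move=> [g [gf fg]]; exists (fmap F g); rewrite -!fmap_comp gf fg !fmap_id.
Qed.

Lemma nat_iso_is_iso (C D : category) (F G : functor C D) (a : nat_iso F G) A :
  is_iso (a A).
Proof. by exists (ni_inv a A); rewrite ni_invK ni_Kinv. Qed.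

(** A [nat_iso] carries its inverses as data while [is_iso] only asserts that they exist, so they
    are picked by choice. *)
Definition nat_iso_of_is_iso (C D : category) (F G : functor C D)
    (a : forall A : C, hom (F A) (G A))
    (aN : forall (A B : C) (f : hom A B), a B ∘ fmap F f = fmap G f ∘ a A)
    (aI : forall A : C, is_iso (a A)) : nat_iso F G :=
  let i A := constructive_indefinite_description _ (aI A) in
  @NatIso _ _ F G a (fun A => proj1_sig (i A)) aN
    (fun A => proj1 (proj2_sig (i A))) (fun A => proj2 (proj2_sig (i A))).

(** The components determine their inverses, and the remaining fields are equations, which proof
    irrelevance identifies. *)
Lemma nat_iso_ext (C D : category) (F G : functor C D) (a b : nat_iso F G) :
  (forall A, a A = b A) -> a = b.
Proof.
case: a b => [a a' an ia ai] [b b' bn ib bi] /= E.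
have {}E : a = b by apply: functional_extensionality_dep.
subst b.
have E' : a' = b'.
  apply: functional_extensionality_dep => A.
  by rewrite -(comp_idr (a' A)) -(bi A) comp_assoc ia comp_idl.
by subst b'; f_equal; apply: proof_irrelevance.
Qed.

(** Fullness gives [e] with [fmap G e] equal to the unit at [G B]. The triangle identities make [e]
    inverse to the counit, on one side after applying the faithful functor [G]. *)
Lemma counit_iso (C D : category) (F : functor C D) (G : functor D C)
    (adj : adjunction F G) (B : D) :
  fully_faithful G -> is_iso (counit adj B).
Proof.
move=> Gff; have [e [He _]] := Gff _ _ (unit adj (G B)).
have ce : counit adj B ∘ e = idm B.
  have [u [_ Hu]] := Gff _ _ (idm (G B)).
  rewrite -(Hu (idm B) (fmap_id G B)); apply: eq_sym; apply: Hu.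
  by rewrite fmap_comp He adj_triangle_r.
by exists e; split => //; rewrite -counit_nat He adj_triangle_l.
Qed.

(** * Functors of two variables *)

(** Keeps the objects of the product category as explicit pairs, so that rewriting sees the two
    variables separately. *)
Definition bimap (C D E : category) (F : functor (prod_cat C D) E)
    (A A' : C) (B B' : D) (a : hom A A') (b : hom B B') :
    hom (F (A, B)) (F (A', B')) :=
  @fmap _ _ F (A, B) (A', B') (a, b).

Section Bimap.
Variables (C D E : category) (F : functor (prod_cat C D) E).

Lemma bimap_comp (A A' A'' : C) (B B' B'' : D) (a' : hom A' A'') (a : hom A A')
    (b' : hom B' B'') (b : hom B B') :
  bimap F a' b' ∘ bimap F a b = bimap F (a' ∘ a) (b' ∘ b).
Proof. by rewrite /bimap -fmap_comp. Qed.

Lemma bimap_iso (A A' : C) (B B' : D) (a : hom A A') (b : hom B B') :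
  is_iso a -> is_iso b -> is_iso (bimap F a b).
Proof.
move=> [a' [a'a aa']] [b' [b'b bb']]; apply: fmap_iso.
by exists (a', b'); rewrite /= a'a aa' b'b bb'.
Qed.

End Bimap.

(** * Pairings on single fibers and their compatibility with pullback *)

Section Pairings.
Variables (C : category) (H1 H2 : fibered C).
Variables (W1 : tensor H1) (W2 : tensor H2) (R : fib_mor H1 H2).

(** Like [tm] and [cn] below, this restates a structural isomorphism with the composite functors in
    its type unfolded, so that such maps compose syntactically. *)
Definition th (T S : C) (f : hom T S) (A : H1 S) :
  hom (pull H2 f (R S A)) (R T (pull H1 f A)) := theta R f A.

Lemma th_nat (T S : C) (f : hom T S) (A B : H1 S) (a : hom A B) :
  th f B ∘ fmap (pull H2 f) (fmap (R S) a)
  = fmap (R T) (fmap (pull H1 f) a) ∘ th f A.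
Proof. exact: (ni_nat (theta R f) a). Qed.

Lemma th_iso (T S : C) (f : hom T S) (A : H1 S) : is_iso (th f A).
Proof. exact: (nat_iso_is_iso (theta R f) A). Qed.

Definition tm (H : fibered C) (W : tensor H) (T S : C) (f : hom T S)
    (A B : H S) : hom (W T (pull H f A, pull H f B)) (pull H f (W S (A, B))) :=
  tens_m W f (A, B).

Lemma tm_nat (H : fibered C) (W : tensor H) (T S : C) (f : hom T S)
    (A A' B B' : H S) (a : hom A A') (b : hom B B') :
  tm W f A' B' ∘ bimap (W T) (fmap (pull H f) a) (fmap (pull H f) b)
  = fmap (pull H f) (bimap (W S) a b) ∘ tm W f A B.
Proof. exact: (@ni_nat _ _ _ _ (tens_m W f) (A, B) (A', B') (a, b)). Qed.

Lemma tm_iso (H : fibered C) (W : tensor H) (T S : C) (f : hom T S)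
    (A B : H S) : is_iso (tm W f A B).
Proof. exact: (nat_iso_is_iso (tens_m W f) (A, B)). Qed.

Definition cn (H : fibered C) (T S V : C) (f : hom T S) (g : hom S V)
    (A : H V) : hom (pull H (g ∘ f) A) (pull H f (pull H g A)) :=
  conn H f g A.

Lemma cn_nat (H : fibered C) (T S V : C) (f : hom T S) (g : hom S V)
    (A B : H V) (a : hom A B) :
  cn f g B ∘ fmap (pull H (g ∘ f)) a
  = fmap (pull H f) (fmap (pull H g) a) ∘ cn f g A.
Proof. exact: (ni_nat (conn H f g) a). Qed.

Lemma cn_iso (H : fibered C) (T S V : C) (f : hom T S) (g : hom S V)
    (A : H V) : is_iso (cn f g A).
Proof. exact: (nat_iso_is_iso (conn H f g) A). Qed.

Lemma th_comp (T S V : C) (f : hom T S) (g : hom S V) (A : H1 V) :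
  fmap (R T) (cn f g A) ∘ th (g ∘ f) A
  = th f (pull H1 g A) ∘ (fmap (pull H2 f) (th g A) ∘ cn f g (R V A)).
Proof. by rewrite comp_assoc; exact: (theta_comp R f g A). Qed.

Lemma tm_comp (H : fibered C) (W : tensor H) (T S V : C) (f : hom T S)
    (g : hom S V) (A B : H V) :
  cn f g (W V (A, B)) ∘ tm W (g ∘ f) A B
  = fmap (pull H f) (tm W g A B)
    ∘ (tm W f (pull H g A) (pull H g B) ∘ bimap (W T) (cn f g A) (cn f g B)).
Proof. by rewrite comp_assoc; exact: (tens_m_comp W f g A B). Qed.

(** Only the components of a candidate for the tensor structure on one fiber; naturality and
    invertibility are established separately. *)
Definition pairing (S : C) :=
  forall A B : H1 S, hom (W2 S (R S A, R S B)) (R S (W1 S (A, B))).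

Definition natural (S : C) (x : pairing S) : Prop :=
  forall (A A' B B' : H1 S) (a : hom A A') (b : hom B B'),
    x A' B' ∘ bimap (W2 S) (fmap (R S) a) (fmap (R S) b)
    = fmap (R S) (bimap (W1 S) a b) ∘ x A B.

(** The equation [rho_pull] for one pair of objects and arbitrary values [x] and [y], so that it can
    be solved for [y] before any pairing over [T] is known. *)
Definition compat_at (T S : C) (f : hom T S) (A B : H1 S)
    (x : hom (W2 S (R S A, R S B)) (R S (W1 S (A, B))))
    (y : hom (W2 T (R T (pull H1 f A), R T (pull H1 f B)))
             (R T (W1 T (pull H1 f A, pull H1 f B)))) : Prop :=
  th f (W1 S (A, B)) ∘ (fmap (pull H2 f) x ∘ tm W2 f (R S A) (R S B))
  = fmap (R T) (tm W1 f A B) ∘ (y ∘ bimap (W2 T) (th f A) (th f B)).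

Definition compat (T S : C) (f : hom T S) (x : pairing S) (y : pairing T) :=
  forall A B, compat_at (x A B) (y (pull H1 f A) (pull H1 f B)).

(** Since [tm] and [th] are invertible, [y] is the conjugate by them of the pullback of [x]. *)
Lemma compat_at_ex (T S : C) (f : hom T S) (A B : H1 S) x :
  exists y, @compat_at T S f A B x y.
Proof.
rewrite /compat_at.
have [m' [m'm mm']] := fmap_iso (R T) (tm_iso W1 f A B).
have [t' [t't tt']] := bimap_iso (W2 T) (th_iso f A) (th_iso f B).
exists (m' ∘ (th f (W1 S (A, B))
              ∘ (fmap (pull H2 f) x ∘ tm W2 f (R S A) (R S B))) ∘ t').
by rewrite -[_ ∘ t' ∘ _]comp_assoc t't comp_idr (comp_assoc _ m') mm' comp_idl.
Qed.

Lemma compat_at_uniq (T S : C) (f : hom T S) (A B : H1 S) x y y' :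
  @compat_at T S f A B x y -> compat_at x y' -> y = y'.
Proof.
rewrite /compat_at => -> /(iso_monic (fmap_iso (R T) (tm_iso W1 f A B))).
exact: (iso_epic (bimap_iso (W2 T) (th_iso f A) (th_iso f B))).
Qed.

Lemma compat_at_iso (T S : C) (f : hom T S) (A B : H1 S) x y :
  @compat_at T S f A B x y -> is_iso x -> is_iso y.
Proof.
rewrite /compat_at => E Hx.
apply: (iso_cancel_r (bimap_iso (W2 T) (th_iso f A) (th_iso f B))).
apply: (iso_cancel_l (fmap_iso (R T) (tm_iso W1 f A B))).
rewrite -E; apply: iso_comp; first exact: th_iso.
by apply: iso_comp; [apply: fmap_iso | apply: tm_iso].
Qed.

(** After composition with the invertible [th] and [tm], the claim becomes the pullback along [f] of
    the assumed naturality square. *)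
Lemma compat_at_nat (T S : C) (f : hom T S) (A A' B B' : H1 S)
    (a : hom A A') (b : hom B B') x x' y y' :
  @compat_at T S f A B x y -> @compat_at T S f A' B' x' y' ->
  x' ∘ bimap (W2 S) (fmap (R S) a) (fmap (R S) b)
  = fmap (R S) (bimap (W1 S) a b) ∘ x ->
  y' ∘ bimap (W2 T) (fmap (R T) (fmap (pull H1 f) a))
                    (fmap (R T) (fmap (pull H1 f) b))
  = fmap (R T) (bimap (W1 T) (fmap (pull H1 f) a) (fmap (pull H1 f) b)) ∘ y.
Proof.
rewrite /compat_at => E E' N.
apply: (iso_epic (bimap_iso (W2 T) (th_iso f A) (th_iso f B))).
apply: (iso_monic (fmap_iso (R T) (tm_iso W1 f A' B'))).
rewrite -!comp_assoc bimap_comp -!th_nat -bimap_comp.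
rewrite (comp_assoc y') comp_assoc -E' -!comp_assoc tm_nat.
rewrite (comp_assoc (fmap _ x')) -fmap_comp N fmap_comp -!comp_assoc.
rewrite (comp_eq_r _ (th_nat _ _)) E.
by rewrite !comp_assoc -!fmap_comp tm_nat.
Qed.

(** Both squares of [compat], for [f] and for [g ∘ f], become the same equation
    after composition with the connection isomorphisms. *)
Lemma compat_at_comp (T S V : C) (f : hom T S) (g : hom S V) (A B : H1 V) x y
    (z : pairing T) : natural z -> @compat_at S V g A B x y ->
  compat_at y (z (pull H1 f (pull H1 g A)) (pull H1 f (pull H1 g B))) <->
  compat_at x (z (pull H1 (g ∘ f) A) (pull H1 (g ∘ f) B)).
Proof.
rewrite /compat_at => Nz Exy.
have EL : fmap (R T) (cn f g (W1 V (A, B)))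
    ∘ (th (g ∘ f) (W1 V (A, B))
       ∘ (fmap (pull H2 (g ∘ f)) x ∘ tm W2 (g ∘ f) (R V A) (R V B)))
  = fmap (R T) (fmap (pull H1 f) (tm W1 g A B))
    ∘ ((th f (W1 S (pull H1 g A, pull H1 g B))
       ∘ (fmap (pull H2 f) y ∘ tm W2 f (R S (pull H1 g A)) (R S (pull H1 g B))))
       ∘ bimap (W2 T) (fmap (pull H2 f) (th g A) ∘ cn f g (R V A))
                      (fmap (pull H2 f) (th g B) ∘ cn f g (R V B))).
  rewrite comp_assoc th_comp -!comp_assoc (comp_eq_r _ (cn_nat _ _ _)) tm_comp.
  rewrite -bimap_comp (comp_eq_r _ (tm_nat _ _ _ _)).
  rewrite -(comp_eq_r _ (th_nat _ _)) !comp_assoc.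
  rewrite -!(comp_assoc (th f _)) -!fmap_comp -!comp_assoc.
  by rewrite Exy !comp_assoc.
have ER : fmap (R T) (cn f g (W1 V (A, B)))
    ∘ (fmap (R T) (tm W1 (g ∘ f) A B)
       ∘ (z (pull H1 (g ∘ f) A) (pull H1 (g ∘ f) B)
          ∘ bimap (W2 T) (th (g ∘ f) A) (th (g ∘ f) B)))
  = fmap (R T) (fmap (pull H1 f) (tm W1 g A B))
    ∘ ((fmap (R T) (tm W1 f (pull H1 g A) (pull H1 g B))
       ∘ (z (pull H1 f (pull H1 g A)) (pull H1 f (pull H1 g B))
          ∘ bimap (W2 T) (th f (pull H1 g A)) (th f (pull H1 g B))))
       ∘ bimap (W2 T) (fmap (pull H2 f) (th g A) ∘ cn f g (R V A))
                      (fmap (pull H2 f) (th g B) ∘ cn f g (R V B))).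
  rewrite comp_assoc -fmap_comp tm_comp !fmap_comp -!comp_assoc.
  by rewrite -(comp_eq_r _ (Nz _ _ _ _ _ _)) !bimap_comp !th_comp.
have iso_m : is_iso (fmap (R T) (fmap (pull H1 f) (tm W1 g A B))).
  by do 2 apply: fmap_iso; apply: tm_iso.
have iso_c : is_iso (fmap (R T) (cn f g (W1 V (A, B)))).
  by apply: fmap_iso; apply: cn_iso.
split=> E.
- by apply: (iso_monic iso_c); rewrite EL ER E.
- rewrite E ER in EL; move: EL => /(iso_monic iso_m) EL.
  apply: (iso_epic _ (eq_sym EL)); apply: bimap_iso;
  by (apply: iso_comp; [apply: fmap_iso; apply: th_iso | apply: cn_iso]).
Qed.

Lemma compat_comp (T S V : C) (f : hom T S) (g : hom S V) x y z :
  natural z -> compat g x y -> compat f y z -> compat (g ∘ f) x z.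
Proof.
by move=> Nz Exy Eyz A B; exact: (proj1 (compat_at_comp f Nz (Exy A B)) (Eyz _ _)).
Qed.

(** The value forced at [A'] and [B'] agrees with that of [y] after composition with an isomorphism
    coming from [A] and [B], by naturality of both pairings. *)
Lemma compat_at_transport (T S : C) (f : hom T S) (x : pairing S)
    (y : pairing T) (A A' B B' : H1 S) (a : hom A A') (b : hom B B') :
  natural x -> natural y -> is_iso a -> is_iso b ->
  compat_at (x A B) (y (pull H1 f A) (pull H1 f B)) ->
  compat_at (x A' B') (y (pull H1 f A') (pull H1 f B')).
Proof.
move=> Nx Ny Ha Hb E.
have [y' E'] := compat_at_ex f (x A' B').
suff -> : y (pull H1 f A') (pull H1 f B') = y' by [].
have Hab : is_iso (bimap (W2 T) (fmap (R T) (fmap (pull H1 f) a))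
                                (fmap (R T) (fmap (pull H1 f) b))).
  by apply: bimap_iso; do 2 apply: fmap_iso.
by apply: (iso_epic Hab); rewrite Ny (compat_at_nat E E' (Nx _ _ _ _ a b)).
Qed.

(** * Uniqueness, cancellation and extension along pullback functors that reach every object *)

Definition ess_surj (T S : C) (f : hom T S) : Prop :=
  forall A : H1 T, exists (A' : H1 S) (a : hom (pull H1 f A') A), is_iso a.

Section EssSurj.
Variables (T S : C) (f : hom T S).
Hypothesis Hf : ess_surj f.

(** Compatibility fixes the values on pulled-back objects, and naturality spreads them along
    isomorphisms to all objects. *)
Lemma compat_uniq (x : pairing S) (y y' : pairing T) :
  natural y -> natural y' -> compat f x y -> compat f x y' ->
  forall A B, y A B = y' A B.
Proof.
move=> Ny Ny' E E' A B.
have [A' [a Ha]] := Hf A; have [B' [b Hb]] := Hf B.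
have Hab := bimap_iso (W2 T) (fmap_iso (R T) Ha) (fmap_iso (R T) Hb).
by apply: (iso_epic Hab); rewrite Ny Ny' (compat_at_uniq (E A' B') (E' A' B')).
Qed.

Lemma compat_iso (x : pairing S) (y : pairing T) :
  natural y -> compat f x y -> (forall A B, is_iso (x A B)) ->
  forall A B, is_iso (y A B).
Proof.
move=> Ny E Hx A B.
have [A' [a Ha]] := Hf A; have [B' [b Hb]] := Hf B.
apply: (iso_cancel_r (bimap_iso (W2 T) (fmap_iso (R T) Ha) (fmap_iso (R T) Hb))).
rewrite Ny; apply: iso_comp; first by apply: fmap_iso; apply: bimap_iso.
exact: compat_at_iso (E A' B') (Hx _ _).
Qed.

(** On objects pulled back along [f] this is the converse direction of [compat_at_comp]; every other
    pair is reached by transport. *)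
Lemma compat_cancel (T' : C) (g : hom T' T) (x : pairing S) (y : pairing T)
    (z : pairing T') :
  natural y -> natural z -> compat f x y -> compat (f ∘ g) x z -> compat g y z.
Proof.
move=> Ny Nz E E' A B.
have [A' [a Ha]] := Hf A; have [B' [b Hb]] := Hf B.
apply: (compat_at_transport Ny Nz Ha Hb).
exact: (proj2 (compat_at_comp g Nz (E A' B')) (E' A' B')).
Qed.

End EssSurj.

(** Every object of the fiber over [T] is the pullback of its image under [G], by the counit. The
    value at [A] and [B] is the one forced at the pullbacks of [G A] and [G B], conjugated by the
    counits. *)
Lemma compat_ext (T S : C) (f : hom T S) (G : right_adjoint (pull H1 f))
    (x : pairing S) : fully_faithful G -> natural x ->
  exists y : pairing T, natural y /\ compat f x y.
Proof.
move=> Gff Nx; pose adj := radj_adj G.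
pose e A := proj1_sig (constructive_indefinite_description _
  (counit_iso adj A Gff)).
have eE A : e A ∘ counit adj A = idm _ /\ counit adj A ∘ e A = idm A.
  by rewrite /e; case: constructive_indefinite_description.
pose w A B := proj1_sig (constructive_indefinite_description _
  (compat_at_ex f (x A B))).
have wE A B : compat_at (x A B) (w A B).
  by rewrite /w; case: constructive_indefinite_description.
have eN A A' (a : hom A A') :
    e A' ∘ a = fmap (pull H1 f) (fmap G a) ∘ e A.
  apply: (iso_monic (counit_iso adj A' Gff)).
  rewrite comp_assoc (proj2 (eE A')) comp_idl comp_assoc counit_nat.
  by rewrite -comp_assoc (proj2 (eE A)) comp_idr.
exists (fun A B => fmap (R T) (bimap (W1 T) (counit adj A) (counit adj B))
  ∘ (w (G A) (G B) ∘ bimap (W2 T) (fmap (R T) (e A)) (fmap (R T) (e B)))).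
split.
- move=> A A' B B' a b; cbv beta.
  (* Naturality of [e] replaces [a] and [b] by pullbacks of maps over [S], where [compat_at_nat]
     applies. *)
  rewrite -!comp_assoc bimap_comp -!fmap_comp !eN !fmap_comp -bimap_comp.
  rewrite (comp_eq_r _ (compat_at_nat (wE _ _) (wE _ _) (Nx _ _ _ _ _ _))).
  by rewrite !comp_assoc -!(fmap_comp (R T)) !bimap_comp !counit_nat.
- move=> A B.
  (* On a pulled-back object the inverse counit is the pullback of the unit, so naturality and a
     triangle identity reduce the value to [w A B]. *)
  have eU A' : e (pull H1 f A') = fmap (pull H1 f) (unit adj A').
    apply: (iso_monic (counit_iso adj _ Gff)).
    by rewrite (proj2 (eE _)) adj_triangle_l.
  cbv beta; rewrite !eU (compat_at_nat (wE A B) (wE _ _) (Nx _ _ _ _ _ _)).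
  rewrite comp_assoc -(fmap_comp (R T)) bimap_comp !adj_triangle_l.
  by rewrite [bimap _ _ _]fmap_id fmap_id comp_idl; exact: wE.
Qed.

End Pairings.

(** * Compatibility of pairings with the shift in one variable *)

Section ShiftedPairings.
Variable C : category.

Definition swap_cat (A B : category) : functor (prod_cat A B) (prod_cat B A) :=
  @Functor (prod_cat A B) (prod_cat B A)
    (fun X => (snd X, fst X)) (fun X Y f => (snd f, fst f))
    (fun X => eq_refl) (fun X Y Z g f => eq_refl).

(** Turns statements on the first variable into statements on the second. *)
Definition tensor_op (H : fibered C) (W : tensor H) : tensor H :=
  @Tensor C H (fun S => fcomp (W S) (swap_cat (H S) (H S)))
    (fun T S f =>
      @NatIso _ _
        (fcomp (fcomp (W T) (swap_cat _ _)) (fprod (pull H f) (pull H f)))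
        (fcomp (pull H f) (fcomp (W S) (swap_cat _ _)))
        (fun X => tens_m W f (snd X, fst X))
        (fun X => ni_inv (tens_m W f) (snd X, fst X))
        (fun X Y g => @ni_nat _ _ _ _ (tens_m W f)
           (snd X, fst X) (snd Y, fst Y) (snd g, fst g))
        (fun X => ni_invK (tens_m W f) (snd X, fst X))
        (fun X => ni_Kinv (tens_m W f) (snd X, fst X)))
    (fun T S V f g A B => tens_m_comp W f g B A).

Definition psh (H : fibered C) (D : tri_fibered H) (T S : C) (f : hom T S)
    (A : H S) :
    hom (pull H f (shift (D S) A)) (shift (D T) (pull H f A)) :=
  tsh (pull_tri D f) A.

Lemma psh_nat (H : fibered C) (D : tri_fibered H) (T S : C) (f : hom T S)
    (A B : H S) (a : hom A B) :
  psh D f B ∘ fmap (pull H f) (fmap (shift (D S)) a)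
  = fmap (shift (D T)) (fmap (pull H f) a) ∘ psh D f A.
Proof. exact: (ni_nat (tsh (pull_tri D f)) a). Qed.

Lemma psh_iso (H : fibered C) (D : tri_fibered H) (T S : C) (f : hom T S)
    (A : H S) : is_iso (psh D f A).
Proof. exact: (nat_iso_is_iso (tsh (pull_tri D f)) A). Qed.

(** Abstracts the shift in one variable so that one argument serves both: the second variable of [W]
    is the first variable of [tensor_op W]. *)
Record left_shift (H : fibered C) (D : tri_fibered H) (W : tensor H) :=
  LeftShift {
  lsh :> forall (S : C) (A B : H S),
    hom (W S (shift (D S) A, B)) (shift (D S) (W S (A, B)));
  lsh_nat : forall (S : C) (A A' B B' : H S) (a : hom A A') (b : hom B B'),
    lsh A' B' ∘ bimap (W S) (fmap (shift (D S)) a) b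
    = fmap (shift (D S)) (bimap (W S) a b) ∘ lsh A B;
  lsh_tm : forall (T S : C) (f : hom T S) (A B : H S),
    psh D f (W S (A, B)) ∘ (fmap (pull H f) (lsh A B) ∘ tm W f (shift (D S) A) B)
    = fmap (shift (D T)) (tm W f A B)
      ∘ (lsh (pull H f A) (pull H f B)
         ∘ bimap (W T) (psh D f A) (idm (pull H f B)))
}.

Definition first_shift (H : fibered C) (D : tri_fibered H) (W : tensor H)
    (tW : tri_tensor D W) : left_shift D W.
Proof.
exists (fun S A B => tsh (bitri_l (tW S) B) A).
- move=> S A A' B B' a b.
  (* The pair of maps is factored through one variable at a time: [a] is handled by naturality of
     [tsh], [b] by [bitri_l_nat]. *)
  rewrite -{1}(comp_idl b) -{1}(comp_idr (fmap (shift (D S)) a)) -bimap_comp.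
  have E1 : tsh (bitri_l (tW S) B') A'
      ∘ bimap (W S) (fmap (shift (D S)) a) (idm B')
      = fmap (shift (D S)) (bimap (W S) a (idm B'))
        ∘ tsh (bitri_l (tW S) B') A.
    exact: (ni_nat (tsh (bitri_l (tW S) B')) a).
  have E2 : tsh (bitri_l (tW S) B') A ∘ bimap (W S) (idm (shift (D S) A)) b
      = fmap (shift (D S)) (bimap (W S) (idm A) b)
        ∘ tsh (bitri_l (tW S) B) A.
    exact: (bitri_l_nat (tW S) A b).
  rewrite comp_assoc E1 -comp_assoc E2 comp_assoc -fmap_comp bimap_comp.
  by rewrite comp_idl comp_idr.
- move=> T S f A B; rewrite !comp_assoc.
  by have := proj1 (tens_m_tri tW f) B A; rewrite /= !comp_assoc.
Defined.

Definition second_shift (H : fibered C) (D : tri_fibered H) (W : tensor H)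
    (tW : tri_tensor D W) : left_shift D (tensor_op W).
Proof.
exists (fun S A B => tsh (bitri_r (tW S) B) A).
- move=> S A A' B B' a b.
  rewrite -{1}(comp_idl b) -{1}(comp_idr (fmap (shift (D S)) a)) -bimap_comp.
  have E1 : tsh (bitri_r (tW S) B') A'
      ∘ bimap (tensor_op W S) (fmap (shift (D S)) a) (idm B')
      = fmap (shift (D S)) (bimap (tensor_op W S) a (idm B'))
        ∘ tsh (bitri_r (tW S) B') A.
    exact: (ni_nat (tsh (bitri_r (tW S) B')) a).
  have E2 : tsh (bitri_r (tW S) B') A
      ∘ bimap (tensor_op W S) (idm (shift (D S) A)) b
      = fmap (shift (D S)) (bimap (tensor_op W S) (idm A) b)
        ∘ tsh (bitri_r (tW S) B) A.
    exact: (bitri_r_nat (tW S) A b).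
  rewrite comp_assoc E1 -comp_assoc E2 comp_assoc -fmap_comp bimap_comp.
  by rewrite comp_idl comp_idr.
- move=> T S f A B; rewrite !comp_assoc.
  by have := proj2 (tens_m_tri tW f) B A; rewrite /= !comp_assoc.
Defined.

Variables (H1 H2 : fibered C) (D1 : tri_fibered H1) (D2 : tri_fibered H2).
Variables (W1 : tensor H1) (W2 : tensor H2) (R : fib_mor H1 H2).
Variables (tR : tri_mor D1 D2 R).

Definition msh (S : C) (A : H1 S) :
    hom (R S (shift (D1 S) A)) (shift (D2 S) (R S A)) := tsh (tR S) A.

Lemma msh_nat (S : C) (A B : H1 S) (a : hom A B) :
  msh B ∘ fmap (R S) (fmap (shift (D1 S)) a)
  = fmap (shift (D2 S)) (fmap (R S) a) ∘ msh A.
Proof. exact: (ni_nat (tsh (tR S)) a). Qed.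

Lemma th_msh (T S : C) (f : hom T S) (A : H1 S) :
  msh (pull H1 f A) ∘ (fmap (R T) (psh D1 f A) ∘ th R f (shift (D1 S) A))
  = fmap (shift (D2 T)) (th R f A)
    ∘ (psh D2 f (R S A) ∘ fmap (pull H2 f) (msh A)).
Proof. by have := theta_tri tR f A; rewrite /= !comp_assoc. Qed.

Variables (l1 : left_shift D1 W1) (l2 : left_shift D2 W2).

(** One half of [bitri_nat] at a single pair of objects, for the variable that [l1] and [l2]
    shift. *)
Definition shift_compat (S : C) (x : pairing W1 W2 R S) (A B : H1 S) : Prop :=
  msh (W1 S (A, B)) ∘ (fmap (R S) (l1 S A B) ∘ x (shift (D1 S) A) B)
  = fmap (shift (D2 S)) (x A B)
    ∘ (l2 S (R S A) (R S B) ∘ bimap (W2 S) (msh A) (idm (R S B))).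

(** After composition with invertible structural maps, both sides are carried through the pullback
    along [f] until the equation at [A] and [B] can be applied inside it. *)
Lemma shift_compat_pull (T S : C) (f : hom T S) (x : pairing W1 W2 R S)
    (y : pairing W1 W2 R T) (A B : H1 S) :
  natural y -> compat f x y -> shift_compat x A B ->
  shift_compat y (pull H1 f A) (pull H1 f B).
Proof.
rewrite /shift_compat => Ny E Ex.
have iso_u : is_iso (bimap (W2 T)
    (fmap (R T) (psh D1 f A) ∘ th R f (shift (D1 S) A)) (th R f B)).
  apply: bimap_iso; last exact: th_iso.
  by apply: iso_comp; [apply: fmap_iso; apply: psh_iso | apply: th_iso].
have iso_v : is_iso (fmap (shift (D2 T)) (fmap (R T) (tm W1 f A B))).
  by do 2 apply: fmap_iso; apply: tm_iso.
apply: (iso_epic iso_u); apply: (iso_monic iso_v); rewrite -!comp_assoc.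
(* Writing the identity as an image under [R T] allows naturality of [y] to be used. *)
have Eb : bimap (W2 T) (fmap (R T) (psh D1 f A) ∘ th R f (shift (D1 S) A))
      (th R f B)
    = bimap (W2 T) (fmap (R T) (psh D1 f A)) (fmap (R T) (idm (pull H1 f B)))
      ∘ bimap (W2 T) (th R f (shift (D1 S) A)) (th R f B).
  by rewrite bimap_comp fmap_id comp_idl.
rewrite [in LHS]Eb.
rewrite (comp_eq_r _ (Ny _ _ _ _ _ _)) -(comp_eq_r _ (msh_nat _)).
have El k : fmap (R T) (fmap (shift (D1 T)) (tm W1 f A B))
    ∘ (fmap (R T) (l1 T (pull H1 f A) (pull H1 f B))
       ∘ (fmap (R T) (bimap (W1 T) (psh D1 f A) (idm (pull H1 f B))) ∘ k))
  = fmap (R T) (psh D1 f (W1 S (A, B)))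
    ∘ (fmap (R T) (fmap (pull H1 f) (l1 S A B))
       ∘ (fmap (R T) (tm W1 f (shift (D1 S) A) B) ∘ k)) .
  by rewrite !comp_assoc -!(fmap_comp (R T)) -!comp_assoc lsh_tm.
(* Compatibility enters here at the shifted pair, and at [A] and [B] themselves in the last line. *)
rewrite El -(E (shift (D1 S) A) B) -(comp_eq_r _ (th_nat _ _ _)).
have Em k : msh (pull H1 f (W1 S (A, B)))
    ∘ (fmap (R T) (psh D1 f (W1 S (A, B)))
       ∘ (th R f (shift (D1 S) (W1 S (A, B))) ∘ k))
  = fmap (shift (D2 T)) (th R f (W1 S (A, B)))
    ∘ (psh D2 f (R S (W1 S (A, B)))
       ∘ (fmap (pull H2 f) (msh (W1 S (A, B))) ∘ k)).
  by have := comp_eq_r k (th_msh f (W1 S (A, B))); rewrite -!comp_assoc.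
rewrite Em.
(* This is the hypothesis at [A] and [B], pulled back along [f]. *)
have Ef k : fmap (pull H2 f) (msh (W1 S (A, B)))
    ∘ (fmap (pull H2 f) (fmap (R S) (l1 S A B))
       ∘ (fmap (pull H2 f) (x (shift (D1 S) A) B) ∘ k))
  = fmap (pull H2 f) (fmap (shift (D2 S)) (x A B))
    ∘ (fmap (pull H2 f) (l2 S (R S A) (R S B))
       ∘ (fmap (pull H2 f) (bimap (W2 S) (msh A) (idm (R S B))) ∘ k)).
  by rewrite !comp_assoc -!(fmap_comp (pull H2 f)) -!comp_assoc Ex.
rewrite Ef (comp_eq_r _ (psh_nat _ _ _)) -tm_nat.
have Et k : psh D2 f (W2 S (R S A, R S B))
    ∘ (fmap (pull H2 f) (l2 S (R S A) (R S B))
       ∘ (tm W2 f (shift (D2 S) (R S A)) (R S B) ∘ k))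
  = fmap (shift (D2 T)) (tm W2 f (R S A) (R S B))
    ∘ (l2 T (pull H2 f (R S A)) (pull H2 f (R S B))
       ∘ (bimap (W2 T) (psh D2 f (R S A)) (idm (pull H2 f (R S B))) ∘ k)).
  by have := comp_eq_r k (lsh_tm l2 f (R S A) (R S B)); rewrite -!comp_assoc.
rewrite Et !bimap_comp fmap_id !comp_idl th_msh.
rewrite -[in RHS](comp_idr (th R f B)) -bimap_comp.
rewrite (comp_eq_r _ (lsh_nat _ _ _)).
rewrite !comp_assoc -!(fmap_comp (shift (D2 T))).
by rewrite -!comp_assoc -E !comp_assoc.
Qed.

Lemma shift_compat_transport (S : C) (x : pairing W1 W2 R S) (A A' B B' : H1 S)
    (a : hom A A') (b : hom B B') :
  natural x -> is_iso a -> is_iso b -> shift_compat x A B ->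
  shift_compat x A' B'.
Proof.
rewrite /shift_compat => Nx Ha Hb E.
have iso_ab : is_iso (bimap (W2 S)
    (fmap (R S) (fmap (shift (D1 S)) a)) (fmap (R S) b)).
  by apply: bimap_iso; do ?apply: fmap_iso.
apply: (iso_epic iso_ab); rewrite -!comp_assoc Nx bimap_comp msh_nat comp_idl.
rewrite (comp_assoc (fmap (R S) (l1 S A' B'))) -(fmap_comp (R S)) lsh_nat.
rewrite fmap_comp -!comp_assoc (comp_eq_r _ (msh_nat _)) E.
rewrite -[in RHS](comp_idr (fmap (R S) b)) -bimap_comp.
rewrite (comp_eq_r _ (lsh_nat _ _ _)) !comp_assoc.
by rewrite -!(fmap_comp (shift (D2 S))) Nx.
Qed.

Lemma shift_compat_ess_surj (T S : C) (f : hom T S) (x : pairing W1 W2 R S)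
    (y : pairing W1 W2 R T) :
  ess_surj H1 f -> natural y -> compat f x y ->
  (forall A B, shift_compat x A B) -> forall A B, shift_compat y A B.
Proof.
move=> Hf Ny E Ex A B.
have [A' [a Ha]] := Hf A; have [B' [b Hb]] := Hf B.
apply: (shift_compat_transport Ny Ha Hb).
exact: (shift_compat_pull Ny E).
Qed.

End ShiftedPairings.

(** * Bi-triangulated pairings: both variables together *)

Section BitriangulatedPairings.
Variables (C : category) (H1 H2 : fibered C).
Variables (D1 : tri_fibered H1) (D2 : tri_fibered H2).
Variables (W1 : tensor H1) (W2 : tensor H2) (R : fib_mor H1 H2).
Variables (tW1 : tri_tensor D1 W1) (tW2 : tri_tensor D2 W2).
Variable (tR : tri_mor D1 D2 R).

Definition flip (S : C) (x : pairing W1 W2 R S) :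
  pairing (tensor_op W1) (tensor_op W2) R S := fun A B => x B A.

Lemma natural_flip (S : C) (x : pairing W1 W2 R S) : natural x -> natural (flip x).
Proof. by move=> Nx A A' B B' a b; apply: Nx. Qed.

Lemma compat_flip (T S : C) (f : hom T S) (x : pairing W1 W2 R S)
    (y : pairing W1 W2 R T) : compat f x y -> compat f (flip x) (flip y).
Proof. by move=> E A B; apply: E. Qed.

Definition bitriangulated (S : C) (x : pairing W1 W2 R S) : Prop :=
  (forall A B, shift_compat tR (first_shift tW1) (first_shift tW2) x A B) /\
  (forall A B,
     shift_compat tR (second_shift tW1) (second_shift tW2) (flip x) A B).

(** The two conditions differ only by the bracketing of composites and the order of the
    quantifiers. *)
Lemma bitri_natE (S : C)
    (mu : nat_iso (fcomp (W2 S) (fprod (R S) (R S))) (fcomp (R S) (W1 S))) :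
  bitri_nat (tR S) (tW1 S) (tW2 S) mu <-> bitriangulated (fun A B => mu (A, B)).
Proof.
rewrite /bitriangulated /shift_compat; split=> -[El Er]; split=> A B.
- by have := El B A; rewrite /= !comp_assoc.
- by have := Er B A; rewrite /= !comp_assoc.
- by have := El B A; rewrite /= !comp_assoc.
- by have := Er B A; rewrite /= !comp_assoc.
Qed.

Lemma bitriangulated_ess_surj (T S : C) (f : hom T S) (x : pairing W1 W2 R S)
    (y : pairing W1 W2 R T) :
  ess_surj H1 f -> natural y -> compat f x y ->
  bitriangulated x -> bitriangulated y.
Proof.
move=> Hf Ny E [Ex1 Ex2]; split.
- exact: (shift_compat_ess_surj Hf Ny E).
- exact: (shift_compat_ess_surj Hf (natural_flip Ny) (compat_flip E)).
Qed.

End BitriangulatedPairings.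

(** * Passage between tensor structures on a morphism and families of pairings *)

Lemma mor_tensor_ext (C : category) (H1 H2 : fibered C)
    (W1 : tensor H1) (W2 : tensor H2) (R : fib_mor H1 H2)
    (r r' : mor_tensor W1 W2 R) :
  (forall (S : C) (A B : H1 S), r S (A, B) = r' S (A, B)) -> r = r'.
Proof.
case: r r' => [r rp] [r' rp'] /= E.
have {}E : r = r'.
  apply: functional_extensionality_dep => S.
  by apply: nat_iso_ext => -[A B]; apply: E.
by subst r'; f_equal; apply: proof_irrelevance.
Qed.

Section MorTensor.
Variables (C : category) (H1 H2 : fibered C).
Variables (W1 : tensor H1) (W2 : tensor H2) (R : fib_mor H1 H2).

Definition to_pairing (r : mor_tensor W1 W2 R) (S : C) : pairing W1 W2 R S :=
  fun A B => r S (A, B).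

Lemma to_pairing_natural (r : mor_tensor W1 W2 R) (S : C) :
  natural (@to_pairing r S).
Proof.
move=> A A' B B' a b.
exact: (@ni_nat _ _ _ _ (r S) (A, B) (A', B') (a, b)).
Qed.

Lemma to_pairing_compat (r : mor_tensor W1 W2 R) (T S : C) (f : hom T S) :
  compat f (@to_pairing r S) (@to_pairing r T).
Proof. by move=> A B; have := rho_pull r f A B; rewrite -!comp_assoc. Qed.

Lemma of_pairing (x : forall S : C, pairing W1 W2 R S) :
  (forall S, natural (x S)) -> (forall S A B, is_iso (x S A B)) ->
  (forall T S (f : hom T S), compat f (x S) (x T)) ->
  exists r : mor_tensor W1 W2 R, forall S A B, r S (A, B) = x S A B.
Proof.
move=> Nx Ix Ex.
pose F S := fcomp (W2 S) (fprod (R S) (R S)); pose G S := fcomp (R S) (W1 S).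
(* Matching on the pair makes [n] compute on explicit pairs, so the final equation holds by
   conversion. *)
pose n S (X : prod_cat (H1 S) (H1 S)) : hom (F S X) (G S X) :=
  let: (A, B) := X in x S A B.
have nN S X Y (g : hom X Y) : n S Y ∘ fmap (F S) g = fmap (G S) g ∘ n S X.
  by case: X Y g => [A B] [A' B'] [a b]; exact: (Nx S A A' B B' a b).
have nI S X : is_iso (n S X) by case: X => A B; apply: Ix.
have rP T S (f : hom T S) A B :
    compat_at (n S (A, B)) (n T (pull H1 f A, pull H1 f B)) := Ex T S f A B.
unshelve eexists.
  exists (fun S => nat_iso_of_is_iso (nN S) (nI S)) => T S f A B.
  by have := rP T S f A B; rewrite /compat_at !comp_assoc.
by [].
Qed.

End MorTensor.

(** * Closed immersions into objects of [U], and extension of the pairing to every fiber *)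

Section BaseCategory.
Variable S : base_category.

(** Factor the map from [X] to the point: smoothness of the second factor puts the middle object in
    [U]. *)
Lemma closed_embedding (X : S) :
  exists (Y : S) (t : hom X Y), in_U Y /\ closed t.
Proof.
have [Y [t [p [Ht [Hp _]]]]] := factorization (to_pt X).
by exists Y, t; split => //; rewrite /in_U -(to_pt_uniq p).
Qed.

(** The product is formed as a fibered product over the point: its projection to [Z] is a base
    change of a smooth map, hence smooth, and [Z] is smooth over the point. *)
Lemma in_U_product (Y Z : S) : in_U Y -> in_U Z ->
  exists (Q : S) (p : hom Q Y) (q : hom Q Z), in_U Q /\ is_product p q.
Proof.
move=> hY hZ.
have [Q [p [q PB]]] := smooth_pullback_exists (to_pt Z) hY.
exists Q, p, q; split.
- rewrite /in_U -(to_pt_uniq (to_pt Z ∘ q)).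
  by apply: smooth_comp => //; apply: smooth_pullback PB.
- move=> X a b; apply: (proj2 PB).
  by rewrite (to_pt_uniq (_ ∘ a)) (to_pt_uniq (_ ∘ b)).
Qed.

Lemma closed_ess_surj (H : fibered S) (D : localic H) (Z X : S) (z : hom Z X) :
  closed z -> ess_surj H z.
Proof.
move=> Hz A; exists (push D Hz A), (counit (radj_adj (push D Hz)) A).
by apply: counit_iso; apply: push_ff.
Qed.

Section Extension.
Variables (H1 H2 : fibered S) (D1 : localic H1).
Variables (W1 : tensor H1) (W2 : tensor H2) (R : fib_mor H1 H2).
Variable r : mor_tensor (res_tensor (@in_U S) W1) (res_tensor (@in_U S) W2)
                        (res_mor (@in_U S) R).

Definition U_pairing (Y : S) (hY : in_U Y) : pairing W1 W2 R Y :=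
  fun A B => r (exist _ Y hY) (A, B).

Lemma U_pairing_natural (Y : S) (hY : in_U Y) : natural (U_pairing hY).
Proof. exact (@to_pairing_natural _ _ _ _ _ _ r (exist _ Y hY)). Qed.

Lemma U_pairing_iso (Y : S) (hY : in_U Y) A B : is_iso (U_pairing hY A B).
Proof. exact: (nat_iso_is_iso (r (exist _ Y hY)) (A, B)). Qed.

Lemma U_pairing_compat (Z Y : S) (hZ : in_U Z) (hY : in_U Y) (g : hom Z Y) :
  compat g (U_pairing hY) (U_pairing hZ).
Proof. exact: (@to_pairing_compat _ _ _ _ _ _ r (exist _ Z hZ) (exist _ Y hY) g). Qed.

(** The pairing is built from one embedding [t], but compatibility is obtained for every map to an
    object of [U]. *)
Lemma extended_pairing (X : S) :
  exists x : pairing W1 W2 R X, natural x /\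
    forall (Y : S) (hY : in_U Y) (h : hom X Y), compat h (U_pairing hY) x.
Proof.
have [Y [t [hY Ht]]] := closed_embedding X.
have [x [Nx Ex]] :=
  compat_ext (@push_ff _ _ D1 _ _ _ Ht) (@U_pairing_natural _ hY).
exists x; split => // Z hZ h.
have [Q [p [q [hQ HQ]]]] := in_U_product hY hZ.
(* [k] is the map with components [t] and [h]; it is a closed immersion because its composite with
   [p] is [t]. *)
have [k [[pk qk] _]] := HQ X t h.
have Hk : closed k by apply: (@closed_cancel _ _ _ _ k p); rewrite pk.
have [x' [Nx' Ex']] :=
  compat_ext (@push_ff _ _ D1 _ _ _ Hk) (@U_pairing_natural _ hQ).
have Ep := compat_comp Nx' (U_pairing_compat hQ hY p) Ex'.
have Eq := compat_comp Nx' (U_pairing_compat hQ hZ q) Ex'.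
rewrite pk in Ep; rewrite qk in Eq.
(* Both pairings are compatible with [t], the second one through [p], so they agree, and [x]
   inherits the compatibility of [x'] with [h] obtained through [q]. *)
have xx' := compat_uniq (closed_ess_surj D1 Ht) Nx Nx' Ex Ep.
by move=> A B; rewrite xx'.
Qed.

End Extension.
End BaseCategory.

(** * Existence and uniqueness of the extended tensor structure *)

Theorem theorem4p1 (S : base_category)
    (H1 H2 : fibered S) (D1 : localic H1) (D2 : localic H2)
    (W1 : tensor H1) (W2 : tensor H2)
    (lW1 : localic_tensor D1 W1) (lW2 : localic_tensor D2 W2)
    (R : fib_mor H1 H2) (lR : localic_mor D1 D2 R)
    (r : mor_tensor (res_tensor (@in_U S) W1) (res_tensor (@in_U S) W2)
                    (res_mor (@in_U S) R)) :
  tri_mor_tensor (res_tri_tensor (@in_U S) lW1) (res_tri_tensor (@in_U S) lW2)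
                 (res_tri_mor (@in_U S) lR) r ->
  exists! r' : mor_tensor W1 W2 R,
    tri_mor_tensor lW1 lW2 lR r' /\ res_mor_tensor (@in_U S) r' = r.
Proof.
move=> tr.
(* The pairing is chosen in the same way over every [X], even in [U]; agreement with [r] there is
   proved afterwards. *)
pose x X := proj1_sig (constructive_indefinite_description _
  (extended_pairing D1 r X)).
have [Nx Ex] : (forall X, natural (x X)) /\
    forall X Y (hY : in_U Y) (h : hom X Y), compat h (U_pairing r hY) (x X).
  by split=> X; rewrite /x; case: constructive_indefinite_description => ? [].
have Ix X A B : is_iso (x X A B).
  have [Y [t [hY Ht]]] := closed_embedding X.
  apply: (compat_iso (closed_ess_surj D1 Ht) (Nx X) (Ex _ _ hY t)).
  exact: U_pairing_iso.
(* Both [t] and [t ∘ f] end in an object of [U], so [Ex] covers both and [t] can be cancelled. *)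
have Cx T X (f : hom T X) : compat f (x X) (x T).
  have [Y [t [hY Ht]]] := closed_embedding X.
  exact: (compat_cancel (closed_ess_surj D1 Ht) (Nx X) (Nx T)
            (Ex _ _ hY t) (Ex _ _ hY (t ∘ f))).
have [r' Er'] := of_pairing Nx Ix Cx.
exists r'; split; first split.
- move=> X; apply/bitri_natE.
  have [Y [t [hY Ht]]] := closed_embedding X.
  apply: (bitriangulated_ess_surj (closed_ess_surj D1 Ht) (x := U_pairing r hY)).
  + exact: to_pairing_natural.
  + by move=> A B; rewrite Er'; apply: Ex.
  + exact: (proj1 (bitri_natE lW1 lW2 lR _) (tr (exist _ Y hY))).
- apply: mor_tensor_ext => -[X hX] A B.
  have [Y [t [hY Ht]]] := closed_embedding X.
  (* Over an object of [U] the chosen pairing and [r] are both compatible with [t], hence equal. *)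
  rewrite [LHS]Er'.
  exact: (compat_uniq (closed_ess_surj D1 Ht) (Nx X)
            (@U_pairing_natural _ _ _ _ _ _ r X hX)
            (Ex _ _ hY t) (U_pairing_compat r hX hY t)).
- move=> r'' [_ res''].
  apply: mor_tensor_ext => X A B; rewrite Er'.
  have [Y [t [hY Ht]]] := closed_embedding X.
  apply: (compat_uniq (closed_ess_surj D1 Ht) (Nx X)
    (@to_pairing_natural _ _ _ _ _ _ r'' X) (Ex _ _ hY t)).
  (* As [r''] restricts to [r], its own compatibility with [t] is compatibility with the pairing of
     [r] over [Y]. *)
  by rewrite -res''; exact: (@to_pairing_compat _ _ _ _ _ _ r'' X Y t).
Qed.
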